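(* Suppose the dichotomic Algorithm 1 (described in the context) terminates without returning ''infeasible'', and let $x_A$ and $\delta$ be the solution and the scalar it returns. Let $\xi^*$ be an optimal solution of $(DW)$ that is supported on at most two indices and satisfies $\sum_{k}\xi^*_k\,\gamma x_k=\beta$, and let $\widetilde x_1,\widetilde x_2$ (possibly coinciding) be the extreme points $x_k$ with $\xi^*_k\neq 0$. Then $$\mu_\delta(\widetilde x_1)=\mu_\delta(\widetilde x_2)=\mu_\delta(x_A).$$ Moreover, $\delta\in\arg\min_{\lambda\ge 0}\theta(\lambda)$.
   Context: Problem $(P)$: maximize $cx$ subject to $x\in X$, $\beta\le\gamma x\le\alpha$ (main additional constraint), and further linear two-sided constraints $\widetilde\beta_k\le\widetilde\gamma^k x\le\widetilde\alpha_k$, where $X\subset\mathbb{R}^n$ is nonempty and the convex hull of $X$ is a polytope. $(SP)$ is the problem $\max_{x\in X}cx$. Standing assumption (LID case): the optimal solution $x^*_{SP}$ of $(SP)$ considered satisfies $\gamma x^*_{SP}\le\beta$. Write $V_1(x)=cx$, $V_2(x)=\gamma x$, $\mu_\delta(x)=V_1(x)+\delta V_2(x)$ for $\delta\ge 0$, and by convention $\mu_{+\infty}(x)=V_2(x)$. Two solutions are Pareto-equal if they have equal $V_1$ values and equal $V_2$ values. $(BOR)$ is the problem of maximizing the vector $(V_1,V_2)$ over $X$. Algorithm 1. Compute $x^*_{SP}$. If $V_2(x^*_{SP})\in[\beta,\alpha]$, return $x_A=x^*_{SP}$, $\delta=0$. Otherwise set $x_A=x^*_{SP}$ and let $x_B\in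 X$ maximize $\mu_{+\infty}=V_2$; if $V_2(x_B)<\beta$, return ''infeasible''. Then repeat: set $\delta=\dfrac{V_1(x_A)-V_1(x_B)}{V_2(x_B)-V_2(x_A)}$ and let $x_C\in X$ maximize $\mu_\delta$ over $X$; if $x_C$ is Pareto-equal to $x_A$ or to $x_B$, stop and return $x_A,x_B,\delta$; otherwise, replace $x_B$ by $x_C$ if $V_2(x_C)\ge\beta$, and replace $x_A$ by $x_C$ if $V_2(x_C)<\beta$. Let $\mathrm{Ext}(X)=\{x_1,\dots,x_K\}$ be the set of extreme points of (the convex hull of) $X$. The Lagrangian function obtained by dualizing the constraint $\beta\le\gamma x$ in $\max\{cx: x\in X,\ \beta\le\gamma x\}$ is $$\theta(\lambda)=\max_{x\in X}\ cx+\lambda(\gamma x-\beta),\qquad \lambda\ge 0,$$ and the Dantzig-Wolfe relaxation is $$(DW)\quad \max_{\xi}\ \sum_{k=1}^K (cx_k)\xi_k\quad\text{s.t.}\quad \sum_{k=1}^K\xi_k=1,\quad \beta\le\sum_{k=1}^K\xi_k\,\gamma x_k,\quad \xi_k\in[0,1]\ \ \forall k.$$ *)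

(* Defs.v *)
From HB Require Import structures.
From mathcomp Require Import all_boot all_order all_algebra.
From mathcomp Require Import boolp classical_sets reals convex.

Set Implicit Arguments.
Unset Strict Implicit.
Unset Printing Implicit Defensive.

Import Order.TTheory GRing.Theory Num.Theory.

Local Open Scope classical_set_scope.
Local Open Scope ring_scope.

Section Optimization.
Variables (R : realType) (T : Type).

Definition argmax (D : set T) (f : T -> R) : set T :=
  [set x | D x /\ forall y, D y -> f y <= f x].

Definition argmin (D : set T) (f : T -> R) : set T :=
  [set x | D x /\ forall y, D y -> f x <= f y].

End Optimization.

Section ConvexGeometry.
Variables (R : realType) (n : nat).
Implicit Types A P : set 'cV[R]_n.

Definition conv_hull A : set 'cV[R]_n :=
  smallest (@convex_set R 'cV[R]_n) A.

Definition polytope P : Prop :=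
  exists s : seq 'cV[R]_n, P = conv_hull [set x | x \in s].

Definition extreme_points P : set 'cV[R]_n :=
  [set x | P x /\ forall y z (t : R), P y -> P z -> 0 < t -> t < 1 ->
     x = t *: y + (1 - t) *: z -> y = x /\ z = x].

(* Ext(X) is meant with respect to the convex hull of X. *)
Definition Ext A : set 'cV[R]_n := extreme_points (conv_hull A).

End ConvexGeometry.

Section Biobjective.
Variables (R : realType) (n : nat).

(* The scalar a x, for a row vector a and a column vector x. *)
Definition lin (a : 'rV[R]_n) (x : 'cV[R]_n) : R := (a *m x) 0 0.

Variables c gamma : 'rV[R]_n.

Definition V1 (x : 'cV[R]_n) : R := lin c x.

Definition V2 (x : 'cV[R]_n) : R := lin gamma x.

(* Only for finite delta; mu_{+oo} is V2 by convention. *)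
Definition mu (delta : R) (x : 'cV[R]_n) : R := V1 x + delta * V2 x.

Definition pareto_equal (x y : 'cV[R]_n) : Prop := V1 x = V1 y /\ V2 x = V2 y.

End Biobjective.

Section Algorithm.
Variables (R : realType) (n : nat).
Variables (X : set 'cV[R]_n) (c gamma : 'rV[R]_n) (beta alpha : R).

Local Notation V1 := (V1 c).
Local Notation V2 := (V2 gamma).
Local Notation mu := (mu c gamma).
Local Notation pareto_equal := (pareto_equal c gamma).

Definition slope (xA xB : 'cV[R]_n) : R := (V1 xA - V1 xB) / (V2 xB - V2 xA).

(* The maximizers computed by the algorithm are arbitrary, so its executions
   are described by relations.  [dichotomic_loop xA xB yA yB delta]: the loop
   entered with the pair (xA, xB) can stop and return (yA, yB, delta). *)
Inductive dichotomic_loop :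
    'cV[R]_n -> 'cV[R]_n -> 'cV[R]_n -> 'cV[R]_n -> R -> Prop :=
| loop_stop xA xB xC :
    argmax X (mu (slope xA xB)) xC ->
    pareto_equal xC xA \/ pareto_equal xC xB ->
    dichotomic_loop xA xB xA xB (slope xA xB)
| loop_replace_B xA xB xC yA yB delta :
    argmax X (mu (slope xA xB)) xC ->
    ~ (pareto_equal xC xA \/ pareto_equal xC xB) ->
    beta <= V2 xC ->
    dichotomic_loop xA xC yA yB delta ->
    dichotomic_loop xA xB yA yB delta
| loop_replace_A xA xB xC yA yB delta :
    argmax X (mu (slope xA xB)) xC ->
    ~ (pareto_equal xC xA \/ pareto_equal xC xB) ->
    V2 xC < beta ->
    dichotomic_loop xC xB yA yB delta ->
    dichotomic_loop xA xB yA yB delta.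

(* No xB is returned when x*_SP already satisfies the main constraint. *)
Inductive outcome :=
| Infeasible
| Returned (xA : 'cV[R]_n) (xB : option 'cV[R]_n) (delta : R).

(* [dichotomic_run xSP o]: some execution in which x*_SP is xSP terminates
   with outcome o. *)
Inductive dichotomic_run (xSP : 'cV[R]_n) : outcome -> Prop :=
| run_immediate :
    argmax X V1 xSP ->
    beta <= V2 xSP <= alpha ->
    dichotomic_run xSP (Returned xSP None 0)
| run_infeasible xB :
    argmax X V1 xSP ->
    ~~ (beta <= V2 xSP <= alpha) ->
    argmax X V2 xB ->
    V2 xB < beta ->
    dichotomic_run xSP Infeasible
| run_loop xB yA yB delta :
    argmax X V1 xSP ->
    ~~ (beta <= V2 xSP <= alpha) ->
    argmax X V2 xB ->
    beta <= V2 xB ->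
    dichotomic_loop xSP xB yA yB delta ->
    dichotomic_run xSP (Returned yA (Some yB) delta).

End Algorithm.

Section Relaxations.
Variables (R : realType) (n : nat).
Variables (c gamma : 'rV[R]_n) (beta : R).

(* When conv_hull X is a polytope and X is nonempty, the maximum over X of a
   linear function is attained, hence equal to this supremum. *)
Definition theta (X : set 'cV[R]_n) (lambda : R) : R :=
  sup [set lin c x + lambda * (lin gamma x - beta) | x in X].

Variables (K : nat) (xs : 'I_K -> 'cV[R]_n).

Definition DW_feasible : set ('I_K -> R) :=
  [set xi | [/\ \sum_k xi k = 1,
                beta <= \sum_k xi k * lin gamma (xs k)
              & forall k, 0 <= xi k <= 1]].

Definition DW_objective (xi : 'I_K -> R) : R := \sum_k lin c (xs k) * xi k.

Definition DW_optimal : set ('I_K -> R) := argmax DW_feasible DW_objective.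

End Relaxations.

(* Main.v *)
Require Import Defs.
From HB Require Import structures.
From mathcomp Require Import all_boot all_order all_algebra.
From mathcomp Require Import boolp classical_sets reals convex.
From mathcomp Require Import interval_inference ring lra.

(** The loop keeps a pair with [V2 xA <= beta <= V2 xB] in which
    [V1 xB <= V1 xA], so every slope is nonnegative.  The slope is the scalar at
    which [mu] takes the same value at [xA] and [xB].  When a maximizer of that
    [mu] is Pareto-equal to one of the two, both are maximizers: the returned
    [delta] is the multiplier of a supporting line of the outcome set, and the
    part of that line inside the convex hull of the outcomes meets the level
    [V2 = beta] ([dichotomic_run_optimal]).  A run that stops before the loop
    is the degenerate case [xB = xA], [delta = 0], [V2 xA = beta].

    Let [M] be the maximum of [mu delta] over [X], and let [z] be the convex
    combination of [xA] and [xB] with [V2 z = beta].  Then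
    [V1 z = M - delta * beta], and both claims are weak duality tested at [z]
    ([optimal_edge_point]).

    - For every multiplier [l], [theta l] dominates the Lagrangian at [xA] and
      [xB], hence its average at [z], which is [V1 z] for every [l]; at [delta]
      this lower bound is attained ([optimal_edge_argmin]).
    - The point [z] lies in the convex hull of [X], a polytope, so it is a
      convex combination of extreme points ([polytope_extreme_points]) and
      yields a feasible solution of the Dantzig-Wolfe relaxation of value
      [M - delta * beta].  An optimal [xi] that is tight at [beta] therefore
      has [mu]-average at least [M], whereas no extreme point exceeds [M]: all
      points carrying weight reach [M] ([DW_support_mu]). *)

Set Implicit Arguments.
Unset Strict Implicit.
Unset Printing Implicit Defensive.

Import Order.TTheory GRing.Theory Num.Theory.

Local Open Scope classical_set_scope.
Local Open Scope ring_scope.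

(** * Linear forms *)

Section LinearForms.
Variables (R : realType) (n : nat).
Implicit Types (a c gamma : 'rV[R]_n) (x y : 'cV[R]_n).

Lemma linD a x y : lin a (x + y) = lin a x + lin a y.
Proof. by rewrite /lin mulmxDr mxE. Qed.

Lemma linZ a t x : lin a (t *: x) = t * lin a x.
Proof. by rewrite /lin -scalemxAr mxE. Qed.

Lemma lin_sum a (I : finType) (w : I -> R) (p : I -> 'cV[R]_n) :
  lin a (\sum_i w i *: p i) = \sum_i w i * lin a (p i).
Proof.
rewrite /lin mulmx_sumr summxE.
by apply: eq_bigr => i _; rewrite -scalemxAr mxE.
Qed.

Lemma mu_lin c gamma d x : mu c gamma d x = lin (c + d *: gamma) x.
Proof. by rewrite /mu /V1 /V2 /lin mulmxDl -scalemxAl !mxE. Qed.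

End LinearForms.

(** * Convex hulls and extreme points *)

Section ConvexCombinations.
Variables (R : realType) (n : nat).
Implicit Types (X D P : set 'cV[R]_n).

Lemma sub_conv_hull X : X `<=` conv_hull X.
Proof. exact: sub_gen_smallest. Qed.

Lemma conv_hull_sub X D : X `<=` D ->
    (forall x y (t : R), 0 <= t -> t <= 1 -> D x -> D y ->
       D (t *: x + (1 - t) *: y)) ->
  conv_hull X `<=` D.
Proof.
move=> XD Dconv; apply: smallest_sub => // x y t /set_mem Dx /set_mem Dy.
apply/mem_set; exact: Dconv.
Qed.

Lemma lin_le_conv_hull X (a : 'rV[R]_n) (M : R) :
  (forall x, X x -> lin a x <= M) -> forall x, conv_hull X x -> lin a x <= M.
Proof.
move=> XM; apply: (@conv_hull_sub X [set x | lin a x <= M]) => // x y t /=.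
by move=> t0 t1 xM yM; rewrite linD !linZ; nra.
Qed.

(** Weights range over a whole finite type and vanish off [A], so that removing
    a point from [A] does not change the index type. *)
Definition convex_combs (I : finType) (p : I -> 'cV[R]_n) (A : {set I}) :
    set 'cV[R]_n :=
  [set x | exists w : I -> R,
     [/\ forall i, 0 <= w i, forall i, i \notin A -> w i = 0,
         \sum_i w i = 1 & x = \sum_i w i *: p i]].

Lemma convex_combs_conv (I : finType) (p : I -> 'cV[R]_n) (A : {set I})
    x y (t : R) : 0 <= t -> t <= 1 ->
  convex_combs p A x -> convex_combs p A y ->
  convex_combs p A (t *: x + (1 - t) *: y).
Proof.
move=> t0 t1 [u [u0 uA u1 ->]] [v [v0 vA v1 ->]].
exists (fun i => t * u i + (1 - t) * v i); split.
- by move=> i; rewrite addr_ge0 // mulr_ge0 // subr_ge0.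
- by move=> i iA; rewrite uA // vA // !mulr0 addr0.
- by rewrite big_split /= -!mulr_sumr u1 v1 !mulr1 addrC subrK.
- rewrite !scaler_sumr -big_split /=; apply: eq_bigr => i _.
  by rewrite !scalerA scalerDl.
Qed.

Lemma mem_convex_combs (I : finType) (p : I -> 'cV[R]_n) (A : {set I}) i :
  i \in A -> convex_combs p A (p i).
Proof.
move=> iA; exists (fun j => (j == i)%:R); split.
- by move=> j; rewrite ler0n.
- by move=> j; case: eqP => // ->; rewrite iA.
- by rewrite (bigD1 i) //= eqxx big1 ?addr0 // => j /negbTE ->.
- rewrite (bigD1 i) //= eqxx scale1r big1 ?addr0 // => j /negbTE ->.
  exact: scale0r.
Qed.

Lemma convex_combs_sub (I J : finType) (p : I -> 'cV[R]_n) (A : {set I})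
    (q : J -> 'cV[R]_n) (B : {set J}) :
  (forall i, i \in A -> convex_combs q B (p i)) ->
  convex_combs p A `<=` convex_combs q B.
Proof.
move=> pq x [w [w0 wA w1 ->]].
have /choice[d dP] : forall i, exists d : J -> R, i \in A ->
    [/\ forall j, 0 <= d j, forall j, j \notin B -> d j = 0,
        \sum_j d j = 1 & p i = \sum_j d j *: q j].
  move=> i; have [iA|iA] := boolP (i \in A); last by exists (fun=> 0).
  by have [d dP] := pq i iA; exists d.
exists (fun j => \sum_i w i * d i j); split.
- move=> j; apply: sumr_ge0 => i _.
  have [iA|iA] := boolP (i \in A); last by rewrite wA // mul0r.
  by have [d0 _ _ _] := dP i iA; rewrite mulr_ge0.
- move=> j jB; apply: big1 => i _.
  have [iA|iA] := boolP (i \in A); last by rewrite wA // mul0r.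
  by have [_ dB _ _] := dP i iA; rewrite dB // mulr0.
- rewrite exchange_big /= -[RHS]w1; apply: eq_bigr => i _; rewrite -mulr_sumr.
  have [iA|iA] := boolP (i \in A); last by rewrite wA // mul0r.
  by have [_ _ d1 _] := dP i iA; rewrite d1 mulr1.
- under [RHS]eq_bigr do rewrite scaler_suml.
  rewrite exchange_big /=; apply: eq_bigr => i _.
  have [iA|iA] := boolP (i \in A); last first.
    by rewrite wA // scale0r big1 // => j _; rewrite mul0r scale0r.
  have [_ _ _ ->] := dP i iA.
  by rewrite scaler_sumr; apply: eq_bigr => j _; rewrite scalerA.
Qed.

(** The crude bound is enough: it makes a linear form bounded above on a
    polytope, so that the supremum defining [theta] is a genuine one. *)
Lemma convex_combs_lin_le (I : finType) (p : I -> 'cV[R]_n) (A : {set I})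
    (a : 'rV[R]_n) x :
  convex_combs p A x -> lin a x <= \sum_i `|lin a (p i)|.
Proof.
move=> [w [w0 wA w1 ->]]; rewrite lin_sum; apply: ler_sum => i _.
have wi1 : w i <= 1 by rewrite -w1 (bigD1 i) //= lerDl sumr_ge0.
apply: le_trans (ler_norm _) _; rewrite normrM ger0_norm //.
by rewrite ler_piMl.
Qed.

(** Moving the term of [p i] to the left-hand side leaves [1 - w i] times
    [p i], and dividing by this positive number gives the weights on the other
    points. *)
Lemma convex_combs_remove (I : finType) (p : I -> 'cV[R]_n) (A : {set I})
    (i : I) (w : I -> R) :
  (forall j, 0 <= w j) -> (forall j, j \notin A -> w j = 0) ->
  \sum_j w j = 1 -> p i = \sum_j w j *: p j -> w i != 1 ->
  convex_combs p (A :\ i) (p i).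
Proof.
move=> w0 wA w1 pi_eq wi_neq1.
have rest_sum : \sum_(j | j != i) w j = 1 - w i.
  by apply/esym/eqP; rewrite subr_eq -w1 (bigD1 i) //= addrC.
have rest_gt0 : 0 < 1 - w i.
  by rewrite lt_def subr_eq0 eq_sym wi_neq1 -rest_sum sumr_ge0.
exists (fun j => if j != i then (1 - w i)^-1 * w j else 0); split.
- by move=> j; case: ifP => // _; rewrite mulr_ge0 // invr_ge0 ltW.
- move=> j; rewrite !inE; case: eqP => //= _ jA.
  by rewrite (wA j) // mulr0.
- by rewrite -big_mkcond /= -mulr_sumr rest_sum mulVf // gt_eqF.
- have -> : p i = (1 - w i)^-1 *: ((1 - w i) *: p i).
    by rewrite scalerA mulVf ?scale1r // gt_eqF.
  have -> : (1 - w i) *: p i = \sum_(j | j != i) w j *: p j.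
    apply/eqP; rewrite scalerBl scale1r subr_eq {1}pi_eq.
    by rewrite (bigD1 i) //= addrC.
  rewrite scaler_sumr big_mkcond /=; apply: eq_bigr => j _.
  by case: ifP => _; rewrite ?scalerA ?scale0r.
Qed.

(** Minkowski's theorem for polytopes.  Among the subfamilies of a finite
    generating family whose combinations still cover [P], take a minimal one,
    [A].  If [p i] lies strictly between two points of [P], then in the induced
    representation of [p i] over [A] the weight of [p i] itself is [1], since
    otherwise [i] could be removed from [A].  Hence both points put all their
    weight on [p i], that is, they are equal to it. *)
Lemma polytope_extreme_points P : polytope P ->
  exists (I : finType) (p : I -> 'cV[R]_n) (A : {set I}),
    P `<=` convex_combs p A /\ forall i, i \in A -> extreme_points P (p i).
Proof.
move=> [s ->]; set P' := conv_hull _.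
pose p := tnth (in_tuple s).
exists 'I_(size s), p.
have pP i : P' (p i) by apply: sub_conv_hull; rewrite /= mem_tnth.
have PT : P' `<=` convex_combs p [set: 'I_(size s)].
  apply: conv_hull_sub => [x /seq_tnthP [i ->]|x y t t0 t1].
    by apply: mem_convex_combs; rewrite inE.
  exact: convex_combs_conv.
have [|A /minsetP[/asboolP PA Amin] _] :=
    @minset_exists _ (fun B => `[< P' `<=` convex_combs p B >])
      [set: 'I_(size s)]%SET.
  exact/asboolP.
exists A; split => // i iA; split => // y z t Py Pz t0 t1 pi_eq.
have [u [u0 uA u1 y_eq]] := PA _ Py; have [v [v0 vA v1 z_eq]] := PA _ Pz.
have irredundant : ~ convex_combs p (A :\ i) (p i).
  move=> piA; suff : A :\ i = A by move/setP/(_ i); rewrite !inE eqxx iA.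
  apply: Amin; last exact: subD1set.
  apply/asboolP; apply: subset_trans PA _; apply: convex_combs_sub => j jA.
  have [->//|ji] := eqVneq j i.
  by apply: mem_convex_combs; rewrite !inE ji.
have /eqP w_i : t * u i + (1 - t) * v i == 1.
  apply: contra_notT irredundant => wi1.
  pose w j := t * u j + (1 - t) * v j.
  apply: (@convex_combs_remove _ _ _ _ w) => //.
  - by move=> j; rewrite addr_ge0 // mulr_ge0 // ?subr_ge0 ltW.
  - by move=> j jA; rewrite /w uA // vA // !mulr0 addr0.
  - by rewrite big_split /= -!mulr_sumr u1 v1 !mulr1 addrC subrK.
  - rewrite {1}pi_eq y_eq z_eq !scaler_sumr -big_split /=.
    by apply: eq_bigr => j _; rewrite !scalerA scalerDl.
have le1 (w : 'I_(size s) -> R) : (forall j, 0 <= w j) -> \sum_j w j = 1 ->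
    w i <= 1.
  by move=> w0 w1; rewrite -w1 (bigD1 i) //= lerDl sumr_ge0.
have vertex (w : 'I_(size s) -> R) : (forall j, 0 <= w j) ->
    \sum_j w j = 1 -> w i = 1 -> \sum_j w j *: p j = p i.
  move=> w0 w1 wi; rewrite (bigD1 i) //= wi scale1r big1 ?addr0 // => j ji.
  have /eqP : \sum_(k | k != i) w k = 0.
    by move: w1; rewrite (bigD1 i) //= wi; lra.
  rewrite psumr_eq0 // => /allP /(_ j).
  by rewrite mem_index_enum ji => /(_ isT) /eqP ->; rewrite scale0r.
have ui := le1 u u0 u1; have vi := le1 v v0 v1.
rewrite y_eq z_eq !vertex //; nra.
Qed.

End ConvexCombinations.

(** * The dichotomic loop *)

Section Loop.
Variables (R : realType) (n : nat) (X : set 'cV[R]_n) (c gamma : 'rV[R]_n).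
Variable beta : R.
Implicit Types (xA xB : 'cV[R]_n) (d : R).

(** The line [mu d = const] supports the outcomes of [X] along a face that
    reaches both sides of the level [beta].  The two points may coincide, when
    [V2 xA = beta]. *)
Definition optimal_edge d xA xB : Prop :=
  [/\ 0 <= d, argmax X (mu c gamma d) xA, argmax X (mu c gamma d) xB,
      V2 gamma xA <= beta & beta <= V2 gamma xB].

(** The last clause covers the start of the loop with [V2 xA = beta], possible
    when [alpha < beta]: then [V2 xB] may equal [V2 xA], the slope is [0] by the
    convention on division by zero, and [xA] has to be optimal for [V1]. *)
Definition loop_inv xA xB : Prop :=
  [/\ X xA, X xB, V2 gamma xA <= beta <= V2 gamma xB,
      forall x, X x -> beta <= V2 gamma x -> V1 c x <= V1 c xA
    & V2 gamma xA = beta -> argmax X (V1 c) xA].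

Lemma mu0 x : mu c gamma 0 x = V1 c x.
Proof. by rewrite /mu mul0r addr0. Qed.

Lemma argmax_mu0 x : argmax X (V1 c) x -> argmax X (mu c gamma 0) x.
Proof. by move=> [Xx xmax]; split => // y Xy; rewrite !mu0; apply: xmax. Qed.

Lemma slope_ge0 xA xB : loop_inv xA xB -> 0 <= slope c gamma xA xB.
Proof.
move=> [_ XB /andP[Ab bB] dom _].
by rewrite divr_ge0 // subr_ge0 ?dom // (le_trans Ab).
Qed.

Lemma mu_slope xA xB : V2 gamma xA < V2 gamma xB ->
  mu c gamma (slope c gamma xA xB) xA = mu c gamma (slope c gamma xA xB) xB.
Proof.
move=> AB; rewrite /mu /slope; have : V2 gamma xB - V2 gamma xA != 0 by lra.
by move=> ?; field.
Qed.

(** Replacing [xB] keeps the invariant at once.  Replacing [xA] by a maximizer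
    [xC] of [mu] at a nonnegative slope with [V2 xC < beta] also does: a point
    with [V2 >= beta] beats [xC] in [V2], so it cannot beat it in [V1]. *)
Lemma dichotomic_loop_optimal xA xB yA yB d :
  dichotomic_loop X c gamma beta xA xB yA yB d -> loop_inv xA xB ->
  exists xB', optimal_edge d yA xB'.
Proof.
elim=> {xA xB yA yB d} [xA xB xC|xA xB xC yA yB d|xA xB xC yA yB d].
- move=> [XC Cmax] Cstop inv; have s0 := slope_ge0 inv.
  have [XA XB /andP[Ab bB] dom Atight] := inv.
  have [AB|BA] := ltP (V2 gamma xA) (V2 gamma xB).
    have eqAB := mu_slope AB.
    have eqC : mu c gamma (slope c gamma xA xB) xC =
               mu c gamma (slope c gamma xA xB) xA.
      by case: Cstop => -[e1 e2]; rewrite ?eqAB /mu e1 e2.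
    exists xB; split=> //; split=> // y Xy; first by rewrite -eqC Cmax.
    by rewrite -eqAB -eqC Cmax.
  (* The denominator of the slope is zero, and xA also plays the part of xB. *)
  have Ab' : V2 gamma xA = beta by apply/eqP; rewrite eq_le Ab (le_trans bB).
  have -> : slope c gamma xA xB = 0.
    rewrite /slope; suff -> : V2 gamma xB = V2 gamma xA.
      by rewrite subrr invr0 mulr0.
    by apply/eqP; rewrite eq_le BA Ab' bB.
  by exists xA; split; rewrite ?Ab' //; apply/argmax_mu0/Atight.
- move=> [XC _] _ bC _ IH [XA _ /andP[Ab _] dom Atight]; apply: IH.
  by split; rewrite ?Ab.
- move=> [XC Cmax] _ Cb _ IH inv; have s0 := slope_ge0 inv.
  have [_ XB /andP[_ bB] _ _] := inv; apply: IH; split => //.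
  + by rewrite ltW.
  + by move=> x Xx bx; have := Cmax x Xx; rewrite /mu; nra.
  + by move=> CB; move: Cb; rewrite CB ltxx.
Qed.

Lemma dichotomic_run_optimal alpha xSP xA oxB d :
  V2 gamma xSP <= beta ->
  dichotomic_run X c gamma beta alpha xSP (Returned xA oxB d) ->
  exists xB, optimal_edge d xA xB.
Proof.
move=> LID run.
inversion run as [SPmax inB| |xB yA yB d' SPmax _ [XB _] bB loop].
  have /andP[bSP _] := inB; subst.
  by exists xA; split; rewrite ?lexx //; exact: argmax_mu0.
subst; apply: dichotomic_loop_optimal loop _.
have [XSP Smax] := SPmax.
by split; rewrite ?LID // => x Xx _; exact: Smax.
Qed.

End Loop.

(** * Lagrangian duality *)

Section Duality.
Variables (R : realType) (n : nat) (X : set 'cV[R]_n) (c gamma : 'rV[R]_n).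
Variables (beta d : R) (xA xB : 'cV[R]_n).
Hypothesis edge : optimal_edge X c gamma beta d xA xB.

(** The last equation is the Lagrangian value: [mu d] is constant along the
    segment, and its [V2] part is fixed at [beta]. *)
Lemma optimal_edge_point : exists t : R,
  [/\ 0 <= t, t <= 1, t * V2 gamma xA + (1 - t) * V2 gamma xB = beta
    & t * V1 c xA + (1 - t) * V1 c xB = mu c gamma d xA - d * beta].
Proof.
have [_ [XA Amax] [XB Bmax] Ab bB] := edge.
have eqAB : mu c gamma d xA = mu c gamma d xB.
  by apply/eqP; rewrite eq_le Amax // Bmax.
have [t [t0 t1 tb]] : exists t : R,
    [/\ 0 <= t, t <= 1 & t * V2 gamma xA + (1 - t) * V2 gamma xB = beta].
  have [AB|BA] := ltP (V2 gamma xA) (V2 gamma xB); last first.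
    by exists 0; split => //; lra.
  have AB0 : 0 < V2 gamma xB - V2 gamma xA by lra.
  exists ((V2 gamma xB - beta) / (V2 gamma xB - V2 gamma xA)); split.
  - by rewrite divr_ge0 //; lra.
  - by rewrite ler_pdivrMr //; lra.
  - by field; rewrite gt_eqF.
exists t; split => //; rewrite -tb /mu.
have -> : V1 c xA = V1 c xB + d * V2 gamma xB - d * V2 gamma xA.
  by move: eqAB; rewrite /mu; lra.
by ring.
Qed.

(** At the point of the edge at level [beta] the Lagrangian does not depend on
    the multiplier, so its value there is a lower bound of [theta]; the
    multiplier [d] attains it because the edge maximizes [mu d]. *)
Lemma optimal_edge_argmin : polytope (conv_hull X) ->
  argmin [set l : R | 0 <= l] (theta c gamma beta X) d.
Proof.
move=> /polytope_extreme_points[I [p [A [PA _]]]].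
have [d0 [XA Amax] [XB _] _ _] := edge.
have [t [t0 t1 tb tM]] := optimal_edge_point.
split=> // l _; apply: (@le_trans _ _ (mu c gamma d xA - d * beta)).
  apply: ge_sup; first by exists (lin c xA + d * (lin gamma xA - beta)), xA.
  by move=> _ [x Xx <-]; have := Amax x Xx; rewrite /mu /V1 /V2; lra.
have bounded : has_ubound [set lin c x + l * (lin gamma x - beta) | x in X].
  exists (\sum_i `|lin (c + l *: gamma) (p i)| - l * beta) => _ [x Xx <-].
  have := convex_combs_lin_le (c + l *: gamma) (PA _ (sub_conv_hull Xx)).
  by rewrite -mu_lin /mu /V1 /V2; lra.
have le_theta x : X x ->
    V1 c x + l * (V2 gamma x - beta) <= theta c gamma beta X l.
  by move=> Xx; apply: (ub_le_sup bounded); exists x.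
have := le_theta _ XA; have := le_theta _ XB.
rewrite -tM => hB hA.
have -> : t * V1 c xA + (1 - t) * V1 c xB =
    t * (V1 c xA + l * (V2 gamma xA - beta)) +
    (1 - t) * (V1 c xB + l * (V2 gamma xB - beta)) by rewrite -tb; ring.
have := ler_wpM2l t0 hA.
have /ler_wpM2l /(_ _ _ hB) : 0 <= 1 - t by lra.
lra.
Qed.

(** Complementary slackness: the gaps [mu d xA - mu d (xs k)] are nonnegative,
    and comparing [xi] with the feasible weights of the edge point shows that
    their [xi]-average is at most zero. *)
Lemma DW_support_mu (K : nat) (xs : 'I_K -> 'cV[R]_n) (xi : 'I_K -> R) :
  polytope (conv_hull X) -> range xs = Ext X -> DW_optimal c gamma beta xs xi ->
  \sum_k xi k * lin gamma (xs k) = beta ->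
  forall k, xi k != 0 -> mu c gamma d (xs k) = mu c gamma d xA.
Proof.
move=> /polytope_extreme_points[I [p [A [PA Aext]]]] xsE.
move=> [[xi1 _ xi01] xi_max] tight.
have [d0 [XA Amax] [XB _] _ _] := edge.
have [t [t0 t1 tb tM]] := optimal_edge_point.
have xs_max k : mu c gamma d (xs k) <= mu c gamma d xA.
  have [hull_k _] : Ext X (xs k) by rewrite -xsE; exists k.
  rewrite mu_lin; apply: lin_le_conv_hull hull_k => x Xx.
  by rewrite -mu_lin; exact: Amax.
have combs x : X x -> convex_combs xs [set: 'I_K]%SET x.
  move=> /sub_conv_hull /PA; apply: convex_combs_sub => i /Aext.
  rewrite -[extreme_points _]/(Ext X) -xsE => -[k _ <-].
  by apply: mem_convex_combs; rewrite inE.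
have [w [w0 _ w1 z_eq]] := convex_combs_conv t0 t1 (combs _ XA) (combs _ XB).
have w_feas : DW_feasible gamma beta xs w.
  split=> // [|k]; first by rewrite -lin_sum -z_eq linD !linZ tb.
  by rewrite w0 -w1 (bigD1 k) //= lerDl sumr_ge0.
have w_obj : DW_objective c xs w = mu c gamma d xA - d * beta.
  rewrite -tM /DW_objective /V1 -!linZ -linD z_eq lin_sum.
  by apply: eq_bigr => k _; rewrite mulrC.
have xi_sum : \sum_k xi k * mu c gamma d (xs k) =
              DW_objective c xs xi + d * beta.
  rewrite -tight mulr_sumr -big_split /=; apply: eq_bigr => k _.
  by rewrite /mu /V1 /V2; ring.
have gap_ge0 k : 0 <= xi k * (mu c gamma d xA - mu c gamma d (xs k)).
  by rewrite mulr_ge0 ?subr_ge0 //; have /andP[] := xi01 k.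
have gap0 : \sum_k xi k * (mu c gamma d xA - mu c gamma d (xs k)) == 0.
  rewrite eq_le sumr_ge0 ?andbT //.
  under eq_bigr do rewrite mulrBr.
  rewrite sumrB -mulr_suml xi1 mul1r xi_sum.
  by have := xi_max _ w_feas; rewrite w_obj; lra.
move=> k xik; move: gap0; rewrite psumr_eq0 // => /allP /(_ k).
rewrite mem_index_enum => /(_ isT) /=.
by rewrite mulf_eq0 (negbTE xik) /= subr_eq0 => /eqP.
Qed.

End Duality.

Theorem mainTheorem2 (R : realType) (n : nat) (X : set 'cV[R]_n)
    (c gamma : 'rV[R]_n) (beta alpha : R)
    (X_nonempty : X !=set0)
    (X_polytope : polytope (conv_hull X))
    (* the run of the algorithm, in the LID case *)
    (xSP xA : 'cV[R]_n) (oxB : option 'cV[R]_n) (delta : R)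
    (LID : V2 gamma xSP <= beta)
    (run : dichotomic_run X c gamma beta alpha xSP (Returned xA oxB delta))
    (* an enumeration of Ext(X) *)
    (K : nat) (xs : 'I_K -> 'cV[R]_n)
    (xs_inj : injective xs)
    (xs_Ext : range xs = Ext X)
    (xi : 'I_K -> R)
    (xi_opt : DW_optimal c gamma beta xs xi)
    (xi_supp : (#|[pred k | xi k != 0%R]| <= 2)%N)
    (xi_tight : \sum_k xi k * lin gamma (xs k) = beta)
    (xt1 xt2 : 'cV[R]_n)
    (xt_supp : [set xs k | k in [set k | xi k != 0]] = [set xt1; xt2]) :
  (mu c gamma delta xt1 = mu c gamma delta xt2 /\
   mu c gamma delta xt2 = mu c gamma delta xA) /\
  argmin [set lambda : R | 0 <= lambda] (theta c gamma beta X) delta.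
Proof.
have [xB edge] := dichotomic_run_optimal LID run.
have xt_mu x : [set xt1; xt2] x -> mu c gamma delta x = mu c gamma delta xA.
  rewrite -xt_supp => -[k xik <-].
  exact: (DW_support_mu edge X_polytope xs_Ext xi_opt xi_tight).
split; last exact: optimal_edge_argmin edge X_polytope.
by rewrite !xt_mu //; [right | left].
Qed.
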